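(* Let $I=[-1,1]$ and let $T\in\mathcal{F}_\infty$ be a Feigenbaum quadratic-like map. Then the Feigenbaum zero topological entropy flow $\mathcal{X}=(I,T)$ is MMA and MMLS.
   Context: Let $I=[-1,1]$ with the usual metric. A quadratic-like map is a $C^3$ map $T:I\to I$ such that: (1) $T(-1)=T(1)=-1$; (2) $T'(0)=0$ and $T''(0)\ne0$; (3) $T'(x)>0$ for $x\in[-1,0)$ and $T'(x)<0$ for $x\in(0,1]$; (4) the Schwarzian derivative $S(T)(x)=\frac{T'''(x)}{T'(x)}-\frac32\left(\frac{T''(x)}{T'(x)}\right)^2$ is negative for all $x\in I$, $x\neq 0$. Let $\mathcal{Q}$ be the space of all quadratic-like maps (with the $C^3$ topology), $\mathcal{Q}_0=\{T\in\mathcal{Q}: ent(T)=0\}$ and $\mathcal{Q}_+=\{T\in\mathcal{Q}: ent(T)>0\}$, where $ent$ denotes topological entropy. The space of Feigenbaum quadratic-like maps is the common boundary $\mathcal{F}_\infty=\partial\mathcal{Q}_0=\partial\mathcal{Q}_+$ in $\mathcal{Q}$. Equivalently, $\mathcal{F}_\infty$ consists of all $T\in\mathcal{Q}$ having the same kneading sequence (the sequence recording, for $n\ge1$, whether $T^n(0)$ is $<0$, $=0$ or $>0$) as the Feigenbaum quadratic polynomial $T_{t_\infty}$, where $T_t(x)=t-(1+t)x^2$ and $t_\infty$ is the limit of the increasing sequence of successive period-doubling parameters of the family $T_t$, $-1/2\le t\le 1$. A flow $(X,T)$ is a compact metric space $(X,d)$ with a continuous map $T:X\to X$. A minimal subset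 $K\subseteq X$ is a non-empty closed subset with $T(K)\subseteq K$ such that $T:K\to K$ is minimal (every forward orbit in $K$ is dense in $K$). The upper density of $E\subseteq\mathbb{N}$ is $\overline{D}(E)=\limsup_{n\to\infty}\frac{\#(E\cap[1,n])}{n}$. A flow is mean-L-stable (MLS) if for every $\epsilon>0$ there is $\delta>0$ such that $d(x,y)<\delta$ implies $d(T^nx,T^ny)<\epsilon$ for all $n=0,1,2,\dots$ except for a set of natural numbers of upper density less than $\epsilon$. A flow $(X,T)$ is minimally mean-L-stable (MMLS) if for every minimal subset $K\subseteq X$ the sub-flow $(K,T)$ is MLS. Given a minimal subset $K$, a point $x\in X$ is mean attracted to $K$ if for every $\epsilon>0$ there is $z=z_{\epsilon,x}\in K$ with $\limsup_{N\to\infty}\frac1N\sum_{n=1}^N d(T^nx,T^nz)<\epsilon$; $\mathrm{Basin}(K)$ is the set of all points mean attracted to $K$. A flow is minimally mean attractable (MMA) if $X=\bigcup_K \mathrm{Basin}(K)$, where $K$ ranges over all minimal subsets of $X$. *)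

(* Defs.v *)
From HB Require Import structures.
From mathcomp Require Export all_boot all_order all_algebra finmap.
From mathcomp Require Export all_classical all_reals all_analysis.

Set Implicit Arguments.
Unset Strict Implicit.
Unset Printing Implicit Defensive.

Export Order.TTheory GRing.Theory Num.Theory.
Export numFieldNormedType.Exports.

Local Open Scope classical_set_scope.
Local Open Scope ring_scope.

(* A flow (X, T) is given by a subset X of an ambient metric space M and a map
   T : M -> M of which only the values on X matter; a subflow is obtained by
   shrinking X. *)

Section Flows.
Context {R : realType} {M : metricType R}.
Implicit Types (X K : set M) (T : M -> M) (E : set nat).

Definition is_flow X T : Prop :=
  [/\ compact X, {within X, continuous T} & forall x, X x -> X (T x)].

(* X is understood to be compact, so that closedness in M and in X agree. *)
Definition minimal_subset X T K : Prop :=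
  [/\ K `<=` X, K !=set0, closed K, (forall x, K x -> K (T x)) &
      forall x, K x -> K `<=` closure [set iter n T x | n in [set: nat]]].

Definition upper_density E : \bar R :=
  limn_esup (fun n => ((\sum_(1 <= k < n.+1) (k \in E))%N%:R / n%:R)%:E).

Definition MLS X T : Prop :=
  forall eps : R, 0 < eps -> exists2 delta : R, 0 < delta &
    forall x y, X x -> X y -> mdist x y < delta ->
      exists2 E : set nat, (upper_density E < eps%:E)%E &
        forall n, ~ E n -> mdist (iter n T x) (iter n T y) < eps.

Definition MMLS X T : Prop := forall K, minimal_subset X T K -> MLS K T.

Definition mean_distance T (x z : M) : \bar R :=
  limn_esup (fun N =>
    (N%:R^-1 * \sum_(1 <= n < N.+1) mdist (iter n T x) (iter n T z))%:E).

Definition mean_attracted T K (x : M) : Prop :=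
  forall eps : R, 0 < eps ->
    exists2 z, K z & (mean_distance T x z < eps%:E)%E.

Definition Basin X T K : set M := [set x | X x /\ mean_attracted T K x].

Definition MMA X T : Prop :=
  X = \bigcup_(K in [set K | minimal_subset X T K]) Basin X T K.

Definition separated X T (n : nat) (eps : R) (F : {fset M}) : Prop :=
  (forall x, x \in F -> X x) /\
  (forall x y, x \in F -> y \in F -> x != y ->
     exists2 k, (k < n)%N & eps < mdist (iter k T x) (iter k T y)).

(* Bowen's definition.  As ln is nondecreasing on the naturals (with ln 0 = 0),
   sep_growth X T eps n is (1/n) log of the largest cardinality of an
   (n, eps)-separated set; it is nonincreasing in eps, so that the limit as eps
   tends to 0 is a supremum. *)
Definition sep_growth X T (eps : R) (n : nat) : \bar R :=
  ereal_sup [set (ln (#|` F|%fset%:R) / n%:R)%:E | F in separated X T n eps].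

Definition ent X T : \bar R :=
  ereal_sup [set limn_esup (sep_growth X T eps) | eps in [set e : R | 0 < e]].

Lemma ent_ge0 X T : (0 <= ent X T)%E.
Proof.
apply: (@le_trans _ _ (limn_esup (sep_growth X T 1))); last first.
  by apply: ereal_sup_ubound; exists 1 => //=.
have h n : (0 <= sep_growth X T 1 n)%E.
  apply: ereal_sup_ubound; exists fset0; last by rewrite cardfs0 ln0 ?mul0r.
  by split=> [x|x y]; rewrite in_fset0.
rewrite limn_esup_lim; apply: lime_ge; first exact: is_cvg_esups.
apply: nearW => n; apply: le_trans (h n) _.
by apply: ereal_sup_ubound; exists n => //=.
Qed.

End Flows.

Section QuadraticLike.
Context {R : realType}.
Implicit Types (S T : R -> R) (A : set (R -> R)).

(* R^o carries the usual distance |y - x| as a metric space. *)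
Definition I11 : set R^o := `[-1, 1]%classic.

(* Derivatives are taken within I11, hence one-sided at the endpoints. *)
Definition diff_quot T (x y : R) : R := (T y - T x) / (y - x).

Definition derivable_I T (x : R) : Prop :=
  cvg (diff_quot T x y @[y --> within I11 x^']).

Definition derive_I T (x : R) : R :=
  lim (diff_quot T x y @[y --> within I11 x^']).

Notation "T ^`I ( k )" := (iter k derive_I T)
  (at level 1, format "T ^`I ( k )").

Definition C3_I T : Prop :=
  (forall k, (k < 3)%N -> forall x, I11 x -> derivable_I T^`I(k) x) /\
  {within I11, continuous T^`I(3)}.

Definition schwarzian T (x : R) : R :=
  T^`I(3) x / T^`I(1) x - 3 / 2 * (T^`I(2) x / T^`I(1) x) ^+ 2.

(* The space Q; elements that agree on I11 represent the same map. *)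
Definition quadratic_like : set (R -> R) := [set T |
  [/\ (forall x, I11 x -> I11 (T x)) /\ C3_I T,
      T (-1) = -1 /\ T 1 = -1,
      T^`I(1) 0 = 0 /\ T^`I(2) 0 <> 0,
      (forall x, -1 <= x < 0 -> 0 < T^`I(1) x) /\
        (forall x, 0 < x <= 1 -> T^`I(1) x < 0) &
      forall x, I11 x -> x <> 0 -> schwarzian T x < 0]].

Definition Q_zero : set (R -> R) :=
  [set T | quadratic_like T /\ ent I11 T = 0%E].

Definition Q_plus : set (R -> R) :=
  [set T | quadratic_like T /\ (0 < ent I11 T)%E].

Definition C3_close (eps : R) S T : Prop :=
  forall k, (k <= 3)%N -> forall x, I11 x -> `|S^`I(k) x - T^`I(k) x| < eps.

(* Closure and boundary in the space Q for the C^3 topology. *)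
Definition closure_Q A : set (R -> R) := [set T | quadratic_like T /\
  forall eps : R, 0 < eps ->
    exists2 S, (quadratic_like `&` A) S & C3_close eps S T].

Definition boundary_Q A : set (R -> R) :=
  closure_Q A `&` closure_Q (quadratic_like `\` A).

Definition Feigenbaum : set (R -> R) := boundary_Q Q_zero.

Lemma FeigenbaumE : Feigenbaum = boundary_Q Q_plus.
Proof.
have -> : Q_plus = quadratic_like `\` Q_zero.
  apply/seteqP; split=> T [QT].
    by move=> h; split=> // -[_ e]; rewrite e ltxx in h.
  move=> h; split=> //; rewrite lt_neqAle ent_ge0 andbT.
  by apply/negP => /eqP e; apply: h; split.
rewrite /Feigenbaum /boundary_Q setIC; congr (_ `&` closure_Q _).
rewrite setDD; apply/seteqP; split=> T; last by case.
by move=> h; split=> //; case: h.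
Qed.

Lemma quadratic_like_flow T : quadratic_like T -> is_flow I11 T.
Proof.
case=> -[IT [dT _]] _ _ _ _; split=> //; first exact: segment_compact.
apply/subspace_continuousP => x Ix.
have /cvg_ex[l dl] : derivable_I T x by exact: (dT 0).
have idx : (y - x) @[y --> within I11 x^'] --> (0 : R).
  rewrite -(subrr x); apply: cvgB; last exact: cvg_cst.
  by move=> B nB; apply: nbhs_dnbhs; apply: filterS nB => z Bz _.
have Tx : T y @[y --> within I11 x^'] --> T x.
  rewrite -[X in _ --> X]addr0 -(mulr0 l).
  have h : T x + diff_quot T x y * (y - x) @[y --> within I11 x^']
      --> T x + l * 0 by apply: cvgD; [exact: cvg_cst|exact: cvgM dl idx].
  apply: cvg_trans h; apply: near_eq_cvg.
  rewrite near_withinE; near=> y => Iy.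
  rewrite /diff_quot divfK ?subrKC// subr_eq0.
  by near: y; exact: nbhs_dnbhs_neq.
move=> B nB; have h : \forall y \near x, y != x -> I11 y -> B (T y).
  exact: Tx _ nB.
change (\forall y \near x, I11 y -> B (T y)).
near=> y => Iy; have [->|yx] := eqVneq y x; first exact: nbhs_singleton.
by have := yx; move: Iy; near: y; apply: filterS h => y hy Iy yx; exact: hy.
Unshelve. all: by end_near. Qed.

End QuadraticLike.

(* Main.v *)
Require Import Defs.
From mathcomp Require Import lra ring zify.
Set Implicit Arguments.
Unset Strict Implicit.
Unset Printing Implicit Defensive.
Local Open Scope classical_set_scope.
Local Open Scope ring_scope.

(** A strict horseshoe of an iterate survives a small uniform perturbation
    ([horseshoe_stable]) and forces positive entropy ([horseshoe_ent_gt0]).  A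
    Feigenbaum map T is a limit of maps of zero entropy, so no iterate of T has
    a strict horseshoe ([Feigenbaum_no_horseshoe]).

    A unimodal map without horseshoes is renormalized over and over by period
    doubling.  Let J be an interval around the turning point c on which
    g = T^N is again unimodal, with its two ends sent to one of them.  If g(c)
    does not go past c, all g-orbits in J are eventually monotone and converge.
    Otherwise there is a fixed point p of g on the other side of c; with q its
    mirror image, g^2(c) cannot leave [q, p] through q, for this would be a
    horseshoe of g^2.  So g^2 maps J' = [q, p] into itself, unimodally, and a
    g-orbit in J either enters J' or is eventually monotone ([step]).  Hence
    each orbit either converges to a periodic orbit or enters intervals J of
    arbitrarily large period N ([deep_level]).

    In the second case two orbits that are in J at the same time are close in
    the mean, whether or not the intervals shrink: the N images of J are
    non-overlapping intervals of [-1, 1], so their lengths add up to at most 2,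
    and the distance of the two orbits is at most 2 / N in the mean
    ([synchronized_dist_sum]).  A minimal set K in the orbit closure of a point
    x passes through J, at any prescribed residue of the time modulo N, so K
    has a point whose orbit is synchronized with that of x: this is mean
    attraction.  A minimal set without periodic points is cut by the images of
    J into N disjoint closed pieces, for overlaps consist of periodic points
    only; so nearby points of K lie in the same piece and stay close in the
    mean: this is mean-L-stability. *)

(** * Horseshoes and renormalization intervals *)

Section Renormalization.
Context {R : realType}.
Implicit Types (f F G : R -> R) (a b c u v x y z : R).

Definition between x y z : Prop := x <= y <= z \/ z <= y <= x.

(** Weak monotonicity, without saying in which sense; unlike the two senses it
    is stable under composition without case distinction. *)
Definition keeps_between F a b : Prop :=
  forall x y z, a <= x -> x <= y -> y <= z -> z <= b ->
    between (F x) (F y) (F z).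

(** Both [x1, x2] and [x3, x4] are stretched by F strictly beyond [x1, x4]: the
    inequalities are strict in order to be stable under perturbation, and the
    two cases are exchanged by reversing the orientation of the line. *)
Definition folds F x1 x2 x3 x4 : Prop :=
  [/\ F x1 < x1, x4 < F x2, x4 < F x3 & F x4 < x1] \/
  [/\ x4 < F x1, F x2 < x1, F x3 < x1 & x4 < F x4].

Definition horseshoe f : Prop := exists m x1 x2 x3 x4,
  [/\ x1 < x2, x2 < x3, x3 < x4 & folds (iter m f) x1 x2 x3 x4].

Definition periodic f x : Prop := exists2 m, (0 < m)%N & iter m f x = x.

Definition tends_to_cycle f x : Prop := exists k N z,
  [/\ (0 < N)%N, iter N f z = z &
      (fun n => iter (k + N * n) f x) @ \oo --> z].

(** [u, v] is an interval of period N around the turning point c: the return map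
    f^N is unimodal on [u, v] and sends both ends to one of them.  The bound in
    [level_dist] stands for the sum of the lengths of the images of [u, v] under
    f, ..., f^N, non-overlapping intervals of [-1, 1]; it is put as a bound
    for the distances of two orbits, which is the form used later and which is
    strong enough for the induction.  [level_return] says that these images
    can meet only in periodic points. *)
Record level f c N u v : Prop := Level {
  level_gt0 : (0 < N)%N;
  level_ltl : u < c;
  level_ltr : c < v;
  level_ends : f u = f v;
  level_turn : forall x, u <= x <= v -> f x = f c -> x = c;
  level_left : forall i, (0 < i <= N)%N -> keeps_between (iter i f) u c;
  level_right : forall i, (0 < i <= N)%N -> keeps_between (iter i f) c v;
  level_fix : iter N f u = u \/ iter N f u = v;
  level_stable : forall x, u <= x <= v -> u <= iter N f x <= v;
  level_dist : forall a b, u <= a <= v -> u <= b <= v ->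
    \sum_(i < N) `|iter i.+1 f a - iter i.+1 f b| <= 2;
  level_return : forall l y, (0 < l < N)%N -> u <= y <= v ->
    u <= iter l f y <= v -> periodic f (iter l f y) }.

Lemma between_sym x y z : between x y z -> between z y x.
Proof. by case; [right|left]. Qed.

Lemma between_dist x y z : between x y z ->
  `|x - y| + `|y - z| = `|x - z|.
Proof.
case=> /andP[xy yz]; have xz := le_trans xy yz.
  by rewrite !ler0_norm ?subr_le0//; lra.
by rewrite !ger0_norm ?subr_ge0//; lra.
Qed.

Lemma between_dist_le x y y' z : between x y z -> between x y' z ->
  `|y - y'| <= `|x - z|.
Proof.
have := ler_norm (x - z); have := ler_norm (z - x); rewrite (distrC z x).
move=> n1 n2 [/andP[h1 h2]|/andP[h1 h2]] [/andP[h3 h4]|/andP[h3 h4]];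
  rewrite ler_norml; apply/andP; split; lra.
Qed.

Lemma continuous_iter f n : continuous f -> continuous (iter n f).
Proof.
move=> cf; elim: n => [|n IHn] x /=; first exact: cvg_id.
exact: continuous_comp (IHn x) (cf _).
Qed.

Lemma ivt F a b y : continuous F -> a <= b ->
  F a <= y <= F b \/ F b <= y <= F a -> exists2 x, a <= x <= b & F x = y.
Proof.
move=> cF ab h.
have [||x] := @IVT R F a b y ab.
- exact: continuous_subspaceT.
- by rewrite ge_min le_max; case: h => /andP[-> ->]; rewrite ?orbT.
by rewrite in_itv/=; exists x.
Qed.

Lemma fixed_limit F z (u : nat -> R) : continuous F ->
  u @ \oo --> z -> (forall n, u n.+1 = F (u n)) -> F z = z.
Proof.
move=> cF uz uS.
have h1 : (fun n => F (u n)) @ \oo --> F z by exact: cvg_comp uz (cF z).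
have h2 : (fun n => u n.+1) @ \oo --> z by rewrite cvg_shiftS.
rewrite -(funext uS) in h1.
exact: cvg_unique h1 h2.
Qed.

Lemma monotone_orbit_cvg F a b x : continuous F ->
  (forall y z, a <= y -> y <= z -> z <= b -> F y <= F z) ->
  (forall n, a <= iter n F x <= b) ->
  exists2 z, F z = z & (fun n => iter n F x) @ \oo --> z.
Proof.
move=> cF mF hx.
have cvgE : cvgn (fun n => iter n F x).
  have /orP[h|h] := le_total x (F x).
    apply: nondecreasing_is_cvgn; last first.
      by exists b => _ [n _ <-]; case/andP: (hx n).
    apply/nondecreasing_seqP; elim=> [|n IHn] //=.
    by apply: mF IHn _; [case/andP: (hx n)|case/andP: (hx n.+1)].
  apply: nonincreasing_is_cvgn; last first.
    by exists a => _ [n _ <-]; case/andP: (hx n).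
  apply/nonincreasing_seqP; elim=> [|n IHn] //=.
  by apply: mF IHn _; [case/andP: (hx n.+1)|case/andP: (hx n)].
move: cvgE => /cvg_ex[z uz]; exists z => //.
exact: fixed_limit cF uz _.
Qed.

Lemma tends_to_cycle_iter f N k x z : (0 < N)%N -> iter N f z = z ->
  (fun n => iter n (iter N f) (iter k f x)) @ \oo --> z -> tends_to_cycle f x.
Proof.
move=> N0 Nz h; exists k, N, z; split=> //.
by under eq_fun do rewrite addnC iterD mulnC iterM.
Qed.

(** F sends [q, c] and [c, p] over [q, p], strictly only at the turning point.
    Its square has four laps; the two middle ones are away from the ends q and
    p, where the strictness fails, and from each other. *)
Lemma fold_square F q c p : continuous F -> q < c -> c < p ->
  F q = p -> F p = p -> F c < q ->
  exists x1 x2 x3 x4, [/\ x1 < x2, x2 < x3, x3 < x4 &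
    folds (F \o F) x1 x2 x3 x4].
Proof.
move=> cF qc cp Fq Fp Fc.
have [||x1 /andP[qx1 x1c] Fx1] := @ivt F q c c cF; first by lra.
  by right; lra.
have [||x2 /andP[x12 x2c] Fx2] := @ivt F x1 c q cF; first by lra.
  by right; lra.
have [||x4 /andP[cx4 x4p] Fx4] := @ivt F c p c cF; first by lra.
  by left; lra.
have [||x3 /andP[cx3 x34] Fx3] := @ivt F c x4 q cF; first by lra.
  by left; lra.
have ne x y : F x <> F y -> x <> y by move=> h e; apply: h; rewrite e.
have lt x y : x <= y -> F x <> F y -> x < y.
  by move=> xy /ne h; rewrite lt_neqAle xy andbT; apply/eqP.
have {}qx1 : q < x1 by apply: lt => //; rewrite Fq Fx1; lra.
have {}x12 : x1 < x2 by apply: lt => //; rewrite Fx2 Fx1; lra.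
have {}x2c : x2 < c by apply: lt => //; rewrite Fx2; lra.
have {}cx3 : c < x3 by apply: lt => //; rewrite Fx3; lra.
have {}x34 : x3 < x4 by apply: lt => //; rewrite Fx3 Fx4; lra.
have {}x4p : x4 < p by apply: lt => //; rewrite Fx4 Fp; lra.
exists x1, x2, x3, x4; split=> //; first by lra.
by left; rewrite /= Fx1 Fx2 Fx3 Fx4 Fq; split; lra.
Qed.

Lemma fold_horseshoe f N q c p : continuous f -> q < c -> c < p ->
  iter N f q = p -> iter N f p = p -> iter N f (iter N f c) < q ->
  horseshoe f.
Proof.
move=> cf qc cp gq gp gc.
have [||||x1 [x2 [x3 [x4 [? ? ? h]]]]] :=
  @fold_square (iter (N + N) f) q c p _ qc cp.
- exact: continuous_iter.
- by rewrite iterD gq.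
- by rewrite iterD gp.
- by rewrite iterD.
exists (N + N + (N + N))%N, x1, x2, x3, x4; split=> //.
by move: h; rewrite /folds /= !iterD.
Qed.

(** * One step of renormalization *)

Lemma level_endr f c N u v : level f c N u v -> iter N f u = u ->
  iter N f v = u.
Proof.
move=> L gu.
by rewrite -gu -(prednK (level_gt0 L)) !iterSr (level_ends L).
Qed.

Lemma level_incr f c N u v x y : level f c N u v -> iter N f u = u ->
  u <= x -> x <= y -> y <= c -> iter N f x <= iter N f y.
Proof.
move=> L gu ux xy yc; have cv := level_ltr L.
have /andP[h _] : u <= iter N f y <= v by apply: level_stable L _ _; lra.
have /andP[h' _] : u <= iter N f x <= v by apply: level_stable L _ _; lra.
have NN : (0 < N <= N)%N by rewrite (level_gt0 L) leqnn.
have := level_left L NN (lexx u) ux xy yc; rewrite gu.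
by case=> /andP[? ?]; lra.
Qed.

Lemma level_decr f c N u v x y : level f c N u v -> iter N f u = u ->
  c <= x -> x <= y -> y <= v -> iter N f y <= iter N f x.
Proof.
move=> L gu cx xy yv; have uc := level_ltl L.
have /andP[h _] : u <= iter N f y <= v by apply: level_stable L _ _; lra.
have /andP[h' _] : u <= iter N f x <= v by apply: level_stable L _ _; lra.
have NN : (0 < N <= N)%N by rewrite (level_gt0 L) leqnn.
have := level_right L NN cx xy yv (lexx v); rewrite (level_endr L gu).
by case=> /andP[? ?]; lra.
Qed.

(** The image of [u, v] under the return map is in [u, c], where this map is
    increasing: orbits are monotone from the first step on. *)
Lemma step_flat f c N u v x : continuous f -> level f c N u v ->
  iter N f u = u -> iter N f c <= c -> u <= x <= v -> tends_to_cycle f x.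
Proof.
move=> cf L gu; set g := iter N f => gc /andP[ux xv].
have [uc cv] := (level_ltl L, level_ltr L).
have incr := level_incr L gu; have decr := level_decr L gu.
have hc y : u <= y <= v -> u <= g y <= c.
  move=> /[dup] uyv /andP[uy yv]; have /andP[-> _] := level_stable L uyv.
  apply: le_trans gc; have [yc|cy] := leP y c; first exact: incr.
  by apply: decr => //; exact: ltW.
have h n : u <= iter n g (g x) <= c.
  elim: n => [|n /andP[IH1 IH2]]; first by apply: (hc x); lra.
  by apply: (hc (iter n g (g x))); lra.
have [z gz xz] := monotone_orbit_cvg (continuous_iter cf) incr h.
exact: tends_to_cycle_iter (level_gt0 L) gz xz.
Qed.

(** With p the fixed point beyond c and q its mirror image, the new interval is
    [q, p].  An orbit that avoids it cannot jump to the right of p after the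
    first step, because it would then land in [q, p]; so it remains to the left
    of q, where the return map is increasing. *)
Lemma step_fold f c N u v x : continuous f -> ~ horseshoe f ->
  level f c N u v -> iter N f u = u -> c < iter N f c -> u <= x <= v ->
  tends_to_cycle f x \/
  exists u' v' k, level f c (N + N) u' v' /\ u' <= iter k f x <= v'.
Proof.
move=> cf nhs L gu; set g := iter N f => gc uxv.
have [uc cv N0] := And3 (level_ltl L) (level_ltr L) (level_gt0 L).
have incr := level_incr L gu; have decr := level_decr L gu.
have gv : g v = u := level_endr L gu.
have cg : continuous g by exact: continuous_iter.
have [||p /andP[cp pv] /eqP] := @ivt (fun y => g y - y) c v 0 _ (ltW cv).
- by move=> y; apply: cvgB; [exact: cg|exact: cvg_id].
- by right; rewrite gv; lra.
rewrite subr_eq0 => /eqP gp.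
have {}cp : c < p.
  by rewrite lt_neqAle cp andbT; apply/eqP => e; move: gc; rewrite {2}e gp; lra.
have {}pv : p < v.
  by rewrite lt_neqAle pv andbT; apply/eqP => e; move: gp; rewrite e gv; lra.
have i1 : (0 < 1 <= N)%N by rewrite N0.
have [|q /andP[uq qc] fq] := @ivt f u c (f p) cf (ltW uc).
  have := level_right L i1 (lexx c) (ltW cp) (ltW pv) (lexx v).
  by rewrite /= (level_ends L); case; [right|left].
have {}qc : q < c.
  rewrite lt_neqAle qc andbT; apply/eqP => e.
  have : p = c by apply: level_turn L _ _ _; [lra|rewrite -fq e].
  by lra.
have fqS i : (0 < i)%N -> iter i f q = iter i f p.
  by case: i => // i _; rewrite !iterSr fq.
have gq : g q = p by rewrite /g fqS.
(* Otherwise the square of g would map both [q, c] and [c, p] over [q, p]. *)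
have ggc : q <= g (g c).
  rewrite leNgt; apply/negP => h.
  exact: (nhs (fold_horseshoe cf qc cp gq gp h)).
have gcv : g c <= v.
  by have /andP[] : u <= g c <= v by apply: level_stable L _ _; lra.
have g1 y : q <= y <= p -> p <= g y <= g c.
  move=> /andP[qy yp]; have [yc|/ltW cy] := leP y c.
    by rewrite -{1}gq !incr//; lra.
  by rewrite -{1}gp !decr//; lra.
have g2 y : p <= y <= g c -> q <= g y <= p.
  move=> /andP[py yg].
  have : g y <= g p by apply: decr; lra.
  have : g (g c) <= g y by apply: decr; lra.
  by rewrite gp; lra.
have L' : level f c (N + N) q p.
  constructor=> //.
  - by rewrite addn_gt0 N0.
  - by move=> y ?; apply: level_turn L _ _; lra.
  - move=> i /andP[i0 iN] x1 x2 x3 h1 h2 h3 h4.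
    have [iN'|Ni] := leqP i N.
      by apply: (level_left L) => //; [rewrite i0|lra].
    rewrite -(subnK (ltnW Ni)) !iterD -/g.
    have ? : p <= g x1 <= g c by apply: g1; lra.
    have ? : p <= g x3 <= g c by apply: g1; lra.
    apply: (level_right L).
    - by rewrite subn_gt0 Ni leq_subLR.
    - by lra.
    - by apply: incr; lra.
    - by apply: incr; lra.
    - by lra.
  - move=> i /andP[i0 iN] x1 x2 x3 h1 h2 h3 h4.
    have [iN'|Ni] := leqP i N.
      by apply: (level_right L) => //; [rewrite i0|lra].
    rewrite -(subnK (ltnW Ni)) !iterD -/g; apply: between_sym.
    have ? : p <= g x1 <= g c by apply: g1; lra.
    have ? : p <= g x3 <= g c by apply: g1; lra.
    apply: (level_right L).
    - by rewrite subn_gt0 Ni leq_subLR.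
    - by lra.
    - by apply: decr; lra.
    - by apply: decr; lra.
    - by lra.
  - by right; rewrite iterD -/g gq gp.
  - by move=> y ?; rewrite iterD; apply/g2/g1.
  (* The images of [q, p] and of [p, g c] under f^(i+1) have f^(i+1) p as a
     common end and together make up the image of [c, g c]. *)
  - move=> a b qa qb; rewrite big_split_ord/= -big_split/=.
    have h : \sum_(i < N) `|iter i.+1 f c - iter i.+1 f (g c)| <= 2.
      by apply: (level_dist L); lra.
    apply: le_trans h; apply: ler_sum => i _.
    have iN : (0 < i.+1 <= N)%N by rewrite /= ltn_ord.
    have bw : between (iter i.+1 f c) (iter i.+1 f p) (iter i.+1 f (g c)).
      have /andP[? ?] : p <= g c <= g c by apply: g1; lra.
      by apply: (level_right L iN); lra.
    rewrite -(between_dist bw); apply: lerD.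
      have bw' y : q <= y <= p ->
          between (iter i.+1 f c) (iter i.+1 f y) (iter i.+1 f p).
        move=> ?; have [yc|/ltW cy] := leP y c.
          apply: between_sym; rewrite -fqS//.
          by apply: (level_left L iN); lra.
        by apply: (level_right L iN); lra.
      exact: between_dist_le (bw' _ qa) (bw' _ qb).
    have bw' y : q <= y <= p ->
        between (iter i.+1 f p) (iter i.+1 f (g y)) (iter i.+1 f (g c)).
      by move=> /g1 ?; apply: (level_right L iN); lra.
    have e y : iter (N + i).+1 f y = iter i.+1 f (g y).
      by rewrite addnC -addSn iterD.
    by have := between_dist_le (bw' _ qa) (bw' _ qb); rewrite -!e.
  - move=> l y /andP[l0 lN] qy qly.
    have [lN'|Nl|lN'] := ltngtP l N.
    - by apply: (level_return L); [rewrite l0|lra..].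
    - move: qly; rewrite -(subnK (ltnW Nl)) iterD -/g => qly.
      have ? := g1 _ qy.
      by apply: (level_return L); [rewrite subn_gt0 Nl ltn_subLR// ltnW|lra..].
    (* [q, p] and its image [p, g c] meet in the fixed point p. *)
    - move: qly; rewrite lN' -/g => qly; have ? := g1 _ qy.
      have -> : g y = p by lra.
      by exists N.
have [[n hn]|/forallNP hn] := pselect (exists n, q <= iter n g x <= p).
  by right; exists q, p, (n * N)%N; rewrite iterM.
left.
have hv n : u <= iter n g x <= v.
  elim: n => [//|n IHn]; exact: level_stable L _ IHn.
have hq n : u <= iter n g (g x) <= q.
  rewrite -iterSr; have /andP[-> _] := hv n.+1; rewrite andTb.
  rewrite leNgt; apply/negP => hqn.
  have pn : p < iter n.+1 g x.
    by rewrite ltNge; apply/negP => ?; apply: (hn n.+1); lra.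
  apply: (hn n.+2); rewrite iterS; apply: g2; rewrite (ltW pn) andTb iterS.
  have /andP[? ?] := hv n.
  by have [nc|/ltW cn] := leP (iter n g x) c; [exact: incr|exact: decr].
have qincr y z : u <= y -> y <= z -> z <= q -> g y <= g z.
  by move=> ? ? ?; apply: incr => //; lra.
have [z gz xz] := monotone_orbit_cvg cg qincr hq.
exact: tends_to_cycle_iter (level_gt0 L) gz xz.
Qed.

(** * Reversing the orientation *)

(** Conjugation by x |-> - x: it exchanges the two possibilities for the end of
    [u, v] that is fixed by the return map. *)
Definition flip f x := - f (- x).

Lemma iter_flip f n x : iter n (flip f) x = - iter n f (- x).
Proof. by elim: n => [|n IHn] /=; rewrite ?IHn /flip !opprK. Qed.

Lemma flipK f : flip (flip f) = f.
Proof. by apply/funext => x; rewrite /flip !opprK. Qed.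

Lemma continuous_flip f : continuous f -> continuous (flip f).
Proof.
move=> cf x; apply: cvgN.
by apply: (@continuous_comp _ _ _ -%R f); [exact: opp_continuous|exact: cf].
Qed.

Lemma horseshoe_flip f : horseshoe f -> horseshoe (flip f).
Proof.
move=> [m [x1 [x2 [x3 [x4 [h12 h23 h34 h]]]]]].
exists m, (- x4), (- x3), (- x2), (- x1); split; try lra.
rewrite /folds !iter_flip !opprK.
by case: h => -[? ? ? ?]; [right|left]; split; lra.
Qed.

Lemma keeps_between_flip f n a b : keeps_between (iter n f) a b ->
  keeps_between (iter n (flip f)) (- b) (- a).
Proof.
move=> h x y z ? ? ? ?; rewrite !iter_flip.
have : between (iter n f (- z)) (iter n f (- y)) (iter n f (- x)).
  by apply: h; lra.
by case=> /andP[? ?]; [left|right]; lra.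
Qed.

Lemma periodic_flip f x : periodic f x -> periodic (flip f) (- x).
Proof. by move=> [m m0 mx]; exists m => //; rewrite iter_flip opprK mx. Qed.

Lemma level_flip f c N u v : level f c N u v ->
  level (flip f) (- c) N (- v) (- u).
Proof.
move=> L; constructor.
- exact: level_gt0 L.
- by rewrite ltrN2 (level_ltr L).
- by rewrite ltrN2 (level_ltl L).
- by rewrite /flip !opprK (level_ends L).
- move=> x hx /oppr_inj; rewrite opprK => fx.
  by rewrite -(level_turn L _ fx) ?opprK//; lra.
- by move=> i hi; apply: keeps_between_flip; exact: (level_right L hi).
- by move=> i hi; apply: keeps_between_flip; exact: (level_left L hi).
- rewrite !iter_flip !opprK.
  have : iter N f v = iter N f u.
    by rewrite -(prednK (level_gt0 L)) !iterSr (level_ends L).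
  by move=> ->; case: (level_fix L) => ->; [right|left].
- move=> x hx; rewrite iter_flip.
  have : u <= iter N f (- x) <= v by apply: level_stable L _ _; lra.
  lra.
- move=> a b ha hb.
  have [ha' hb'] : u <= - a <= v /\ u <= - b <= v by split; lra.
  apply: le_trans (level_dist L ha' hb'); apply: ler_sum => i _.
  by rewrite !iter_flip -normrN opprD !opprK.
- move=> l y hl hy; rewrite iter_flip => hly.
  by apply: periodic_flip; apply: (level_return L) => //; lra.
Qed.

Lemma tends_to_cycle_flip f x : tends_to_cycle f x ->
  tends_to_cycle (flip f) (- x).
Proof.
move=> [k [N [z [N0 Nz xz]]]]; exists k, N, (- z); split=> //.
  by rewrite iter_flip opprK Nz.
under eq_fun do rewrite iter_flip opprK.
exact: cvgN.
Qed.

Lemma step_fixl f c N u v x : continuous f -> ~ horseshoe f ->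
  level f c N u v -> iter N f u = u -> u <= x <= v ->
  tends_to_cycle f x \/
  exists u' v' k, level f c (N + N) u' v' /\ u' <= iter k f x <= v'.
Proof.
move=> cf nhs L gu uxv; have [gc|gc] := leP (iter N f c) c.
  by left; exact: step_flat L gu gc uxv.
exact: step_fold L gu gc uxv.
Qed.

Lemma step f c N u v x : continuous f -> ~ horseshoe f ->
  level f c N u v -> u <= x <= v ->
  tends_to_cycle f x \/
  exists u' v' k, level f c (N + N) u' v' /\ u' <= iter k f x <= v'.
Proof.
move=> cf nhs L uxv.
have [gu|gu] := level_fix L; first exact: step_fixl L gu uxv.
have [|||t|[u' [v' [k [L' hk]]]]] :=
  @step_fixl (flip f) (- c) N (- v) (- u) (- x) (continuous_flip cf) _
    (level_flip L).
- by move=> /horseshoe_flip; rewrite flipK.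
- rewrite iter_flip opprK; congr (- _); rewrite -[RHS]gu.
  by rewrite -(prednK (level_gt0 L)) !iterSr (level_ends L).
- by lra.
- by left; have := tends_to_cycle_flip t; rewrite flipK opprK.
right; exists (- v'), (- u'), k; split.
  by have := level_flip L'; rewrite flipK opprK.
by move: hk; rewrite iter_flip opprK; lra.
Qed.

(** * Deep intervals and mean distances *)

Lemma deep_level f c u v n x : continuous f -> ~ horseshoe f ->
  level f c 1 u v -> u <= x <= v ->
  tends_to_cycle f x \/ exists N u' v' k,
    [/\ level f c N u' v', (n <= N)%N & u' <= iter k f x <= v'].
Proof.
move=> cf nhs L uxv; elim: n => [|n [IHn|[N [u' [v' [k [L' nN hk]]]]]]].
- by right; exists 1, u, v, 0%N.
- by left.
have [t|[u2 [v2 [k2 [L2 hk2]]]]] := step cf nhs L' hk.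
  left; case: t => k2 [N2 [z [? ? h]]]; exists (k2 + k)%N, N2, z; split=> //.
  by under eq_fun do rewrite addnAC iterD.
right; exists (N + N)%N, u2, v2, (k2 + k)%N; rewrite iterD; split=> //.
by have := level_gt0 L'; lia.
Qed.

Lemma level_stable_mul f c N u v m x : level f c N u v -> u <= x <= v ->
  u <= iter (m * N) f x <= v.
Proof.
move=> L hx; elim: m => // m IHm.
by rewrite mulSn iterD; exact: level_stable L _ IHm.
Qed.

(** [level_dist] is a bound for one period; both orbits are back in [u, v] after
    it. *)
Lemma level_dist_sum f c N u v m a b : level f c N u v ->
  u <= a <= v -> u <= b <= v ->
  \sum_(i < m) `|iter i.+1 f a - iter i.+1 f b| <= 2 * (m%:R / N%:R + 1).
Proof.
move=> L; have N0 := level_gt0 L.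
have NR : (0 : R) < N%:R by rewrite ltr0n.
elim/ltn_ind: m a b => m IHm a b ha hb; have [mN|Nm] := leqP m N.
  apply: (@le_trans _ _ 2); last first.
    by rewrite -[leLHS]mulr1 ler_pM2l// lerDr divr_ge0.
  apply: le_trans (level_dist L ha hb).
  by rewrite -(subnKC mN) [leRHS]big_split_ord/= lerDl; exact: sumr_ge0.
rewrite -(subnKC (ltnW Nm)) big_split_ord/=.
have h := level_dist L ha hb.
have mNm : (m - N < m)%N by lia.
have IH := IHm _ mNm _ _ (level_stable L ha) (level_stable L hb).
have -> : 2 * ((N + (m - N))%:R / N%:R + 1) =
    2 + 2 * ((m - N)%:R / N%:R + 1) :> R.
  by rewrite natrD; field; rewrite gt_eqF.
apply: lerD h _; apply: le_trans IH; apply: ler_sum => i _.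
by rewrite -!iterS -addnS addnC !iterD.
Qed.

(** Two orbits that are in [u, v] at the same time j are from then on at mean
    distance at most 2 / N. *)
Lemma synchronized_dist_sum f c N u v j m a b : level f c N u v ->
  u <= iter j f a <= v -> u <= iter j f b <= v ->
  \sum_(i < m) `|iter i.+1 f a - iter i.+1 f b| <=
    \sum_(i < j) `|iter i.+1 f a - iter i.+1 f b| + 2 + 2 / N%:R * m%:R.
Proof.
move=> L ha hb.
apply: (@le_trans _ _ (\sum_(i < j + m) `|iter i.+1 f a - iter i.+1 f b|)).
  rewrite addnC big_split_ord/= lerDl; exact: sumr_ge0.
rewrite big_split_ord/= -addrA lerD2l.
have -> : 2 + 2 / N%:R * m%:R = 2 * (m%:R / N%:R + 1) :> R by ring.
apply: le_trans (level_dist_sum m L ha hb).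
by apply: ler_sum => i _; rewrite -!iterS -addnS addnC !iterD.
Qed.

End Renormalization.

(** * Retraction of the line onto the interval *)

Section Clamp.
Context {R : realType}.
Implicit Types (S T f : R -> R) (x y : R).

(** Composing with the retraction of the line onto [-1, 1] extends a map of
    [-1, 1] to a continuous map of the line with the same orbits in [-1, 1]. *)
Definition clamp x : R := if x < -1 then -1 else if 1 < x then 1 else x.

Lemma I11E x : I11 x <-> -1 <= x <= 1.
Proof. by rewrite /I11 /= in_itv. Qed.

Lemma clamp_bound x : -1 <= clamp x <= 1.
Proof. by rewrite /clamp; case: ltP => ?; [|case: ltP => ?]; lra. Qed.

Lemma clampK x : -1 <= x <= 1 -> clamp x = x.
Proof. by rewrite /clamp => hx; case: ltP => ?; [|case: ltP => ?]; lra. Qed.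

Lemma clamp_lipschitz x y : `|clamp x - clamp y| <= `|x - y|.
Proof.
have := ler_norm (x - y); have := ler_norm (y - x); rewrite (distrC y x).
rewrite ler_norml /clamp => h1 h2.
by case: (ltP x) => ?; [|case: (ltP 1 x) => ?];
  (case: (ltP y) => ?; [|case: (ltP 1 y) => ?]); apply/andP; split; lra.
Qed.

Lemma clamp_continuous : continuous clamp.
Proof.
move=> x; apply/cvgrPdist_lt => e e0; near=> y.
apply: le_lt_trans (clamp_lipschitz x y) _.
by near: y; apply: (@cvgr_dist_lt _ _ _ (nbhs x) _ id x) => //; exact: cvg_id.
Unshelve. all: by end_near. Qed.

Lemma continuous_clamp T : {within I11, continuous T} ->
  continuous (T \o clamp).
Proof.
move=> /subspace_continuousP cT x B nB.
have cx : I11 (clamp x) by apply/I11E/clamp_bound.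
have h : \forall z \near clamp x, I11 z -> B (T z) := cT _ cx _ nB.
have h' : \forall y \near x, I11 (clamp y) -> B (T (clamp y)).
  exact: (@clamp_continuous x _ h).
change (\forall y \near x, B (T (clamp y))).
by apply: filterS h' => y; apply; exact/I11E/clamp_bound.
Qed.

Lemma iter_clamp T n x : (forall x, I11 x -> I11 (T x)) -> I11 x ->
  I11 (iter n T x) /\ iter n (T \o clamp) x = iter n T x.
Proof.
move=> IT Ix; elim: n => [|n [In IHn]] /=; first by split.
by split; [exact: IT|rewrite IHn /= clampK//; apply/I11E].
Qed.

End Clamp.

(** * Horseshoes and entropy *)

Section Horseshoes.
Context {R : realType}.
Implicit Types (S T f g : R -> R) (x y : R).

Lemma iter_stable f x m (eta : R) : continuous f -> 0 < eta ->
  \forall e \near (0 : R)^'+, forall g, (forall y, `|g y - f y| < e) ->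
    `|iter m g x - iter m f x| < eta.
Proof.
move=> cf; elim: m eta => [|m IHm] eta eta0.
  by apply: nearW => e g _; rewrite subrr normr0.
have : \forall y \near iter m f x, `|f (iter m f x) - f y| < eta / 2.
  by move/cvgrPdist_lt: (cf (iter m f x)); apply; rewrite divr_gt0.
move=> /nbhs_ballP[d /= d0 hd].
have := IHm d d0; apply: filterS2 (nbhs_right_lt (divr_gt0 eta0 (ltr0Sn R 1))).
move=> e he hg g gf; have {}hg := hg g gf.
have := hd (iter m g x); rewrite /ball/= distrC => /(_ hg) h.
have h' := gf (iter m g x).
rewrite -(subrKA (f (iter m g x))) (le_lt_trans (ler_normD _ _))//.
by rewrite (distrC (f _)); lra.
Qed.

Lemma horseshoe_stable f : continuous f -> horseshoe f ->
  \forall e \near (0 : R)^'+, forall g, (forall y, `|g y - f y| < e) ->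
    horseshoe g.
Proof.
move=> cf [m [x1 [x2 [x3 [x4 [h12 h23 h34 h]]]]]].
have lt x y : iter m f x < y -> \forall e \near (0 : R)^'+,
    forall g, (forall y, `|g y - f y| < e) -> iter m g x < y.
  rewrite -subr_gt0 => /(iter_stable x m cf); apply: filterS => e he g /he.
  by rewrite ltr_norml; lra.
have gt x y : y < iter m f x -> \forall e \near (0 : R)^'+,
    forall g, (forall y, `|g y - f y| < e) -> y < iter m g x.
  rewrite -subr_gt0 => /(iter_stable x m cf); apply: filterS => e he g /he.
  by rewrite ltr_norml; lra.
case: h => -[h1 h2 h3 h4]; near=> e => g gf; exists m, x1, x2, x3, x4.
  split=> //; left; split.
  - by move: gf; apply: (near (lt _ _ h1) e).
  - by move: gf; apply: (near (gt _ _ h2) e).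
  - by move: gf; apply: (near (gt _ _ h3) e).
  - by move: gf; apply: (near (lt _ _ h4) e).
split=> //; right; split.
- by move: gf; apply: (near (gt _ _ h1) e).
- by move: gf; apply: (near (lt _ _ h2) e).
- by move: gf; apply: (near (lt _ _ h3) e).
- by move: gf; apply: (near (gt _ _ h4) e).
Unshelve. all: by end_near. Qed.

(** Symbolic coding: the point of a word is found by pulling back letter by
    letter, with the intermediate value theorem on [x1, x2] or on [x3, x4]. *)
Lemma folds_code G x1 x2 x3 x4 : continuous G -> x1 < x2 -> x2 < x3 ->
  x3 < x4 -> folds G x1 x2 x3 x4 ->
  exists code : seq bool -> R, forall b w,
    [/\ x1 <= code w <= x4, (if b then x3 <= code (b :: w)
      else code (b :: w) <= x2) & G (code (b :: w)) = code w].
Proof.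
move=> cG h12 h23 h34 h.
have pre (b : bool) y : exists x, x1 <= y <= x4 ->
    [/\ x1 <= x <= x4, (if b then x3 <= x else x <= x2) & G x = y].
  have [hy|hy] := pselect (x1 <= y <= x4); last by exists 0.
  have [x [hx hb Gx]] : exists x, [/\ x1 <= x <= x4,
      (if b then x3 <= x else x <= x2) & G x = y].
    case: b.
      have [||x /andP[? ?] Gx] := @ivt _ G x3 x4 y cG; first exact: ltW.
        by case: h => -[? ? ? ?]; [right|left]; lra.
      by exists x; split=> //; lra.
    have [||x /andP[? ?] Gx] := @ivt _ G x1 x2 y cG; first exact: ltW.
      by case: h => -[? ? ? ?]; [left|right]; lra.
    by exists x; split=> //; lra.
  by exists x.
pose next b y := sval (cid (pre b y)).
have nextP b y : x1 <= y <= x4 -> [/\ x1 <= next b y <= x4,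
    (if b then x3 <= next b y else next b y <= x2) & G (next b y) = y].
  exact: svalP (cid (pre b y)).
pose code := foldr next x1.
have hc w : x1 <= code w <= x4.
  by elim: w => [|b w /(nextP b)[]//]; rewrite /code/=; lra.
by exists code => b w; have [] := nextP b _ (hc w).
Qed.

Lemma code_separated G (code : seq bool -> R) x2 x3 : x2 < x3 ->
  (forall b w, (if b then x3 <= code (b :: w) else code (b :: w) <= x2) /\
     G (code (b :: w)) = code w) ->
  forall w w', size w = size w' -> w <> w' -> exists2 i, (i < size w)%N &
    x3 - x2 <= `|iter i G (code w) - iter i G (code w')|.
Proof.
move=> h23 hc; elim=> [|b w IHw] [|b' w']//= [ww'] ne.
have [bb|bb] := eqVneq b b'.
  rewrite -bb in ne *.
  have [|i iw hi] := IHw w' ww'; first by move=> e; apply: ne; rewrite e.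
  by exists i.+1 => //; rewrite !iterSr; have [_ ->] := hc b w;
    have [_ ->] := hc b w'.
exists 0%N => //=; have [+ _] := hc b w; have [+ _] := hc b' w'.
have := ler_norm (code (b :: w) - code (b' :: w')).
have := ler_norm (code (b' :: w') - code (b :: w)).
rewrite (distrC (code (b' :: w'))).
by clear ne; case: b b' bb => -[]//= _; lra.
Qed.

Lemma limn_esup_ge (u : (\bar R)^nat) (l : \bar R) :
  (forall n, exists2 k, (n <= k)%N & (l <= u k)%E) -> (l <= limn_esup u)%E.
Proof.
move=> h; rewrite limn_esup_lim; apply: lime_ge; first exact: is_cvg_esups.
apply: nearW => n; have [k nk lk] := h n; apply: le_trans lk _.
by apply: ereal_sup_ubound; exists k.
Qed.

(** The points of the 2^k words of length k are separated within k m steps, m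
    being the iterate that has the horseshoe; so the entropy is at least
    ln 2 / m. *)
Lemma horseshoe_ent_gt0 S : {within I11, continuous S} ->
  (forall x, I11 x -> I11 (S x)) -> horseshoe (S \o clamp) ->
  (0 < ent (I11 : set R^o) S)%E.
Proof.
move=> cS IS [m [x1 [x2 [x3 [x4 [h12 h23 h34 h]]]]]].
have cf := continuous_clamp cS.
have m0 : (0 < m)%N by case: m h => [|//] [|] [/= ? ? ? ?]; exfalso; lra.
have hI x : -1 <= iter m (S \o clamp) x <= 1.
  by rewrite -(prednK m0) iterS; apply/I11E/IS/I11E/clamp_bound.
have x1I : -1 < x1.
  case: h => -[h1 ? ? h4];
    [have /andP[? ?] := hI x1|have /andP[? ?] := hI x2]; lra.
have x4I : x4 < 1.
  case: h => -[h1 ? ? h4];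
    [have /andP[? ?] := hI x2|have /andP[? ?] := hI x4]; lra.
have [code hc] := folds_code (@continuous_iter _ _ m cf) h12 h23 h34 h.
have codeI w : I11 (code w).
  by apply/I11E; have [/andP[? ?] _ _] := hc true w; lra.
have sep := @code_separated (iter m (S \o clamp)) code x2 x3 h23 _.
have {}sep : forall w w', size w = size w' -> w <> w' ->
    exists2 k, (k < size w * m)%N &
    (x3 - x2) / 2 < mdist (iter k S (code w) : R^o) (iter k S (code w')).
  move=> w w' ww' ne.
  have [|i iw hi] := sep _ w w' ww' ne.
    by move=> b w0; have [] := hc b w0.
  exists (i * m)%N; first by rewrite ltn_pmul2r.
  have e u : iter i (iter m (S \o clamp)) (code u) = iter (i * m) S (code u).
    by rewrite -iterM; have [_ ->] := iter_clamp (i * m) IS (codeI u).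
  rewrite !e in hi; rewrite metric_sym; apply: lt_le_trans hi; lra.
pose eps := (x3 - x2) / 2.
have growth k : (0 < k)%N ->
    ((ln 2 / m%:R)%:E <= sep_growth (I11 : set R^o) S eps (k * m))%E.
  move=> k0; apply: ereal_sup_ubound.
  pose s := [seq code (val t) | t <- enum {: k.-tuple bool}].
  have us : uniq s.
    rewrite map_inj_uniq ?enum_uniq// => t t' ett'.
    apply/val_inj/eqP/negPn/negP => /eqP ne.
    have [|i _] := sep (val t) (val t') _ ne; first by rewrite !size_tuple.
    by rewrite ett' mdistxx ltNge divr_ge0// subr_ge0 ltW.
  exists (seq_fset tt (s : seq R^o)).
    split=> [x|x y].
      by rewrite seq_fsetE => /mapP[t _ ->]; exact: codeI.
    rewrite !seq_fsetE => /mapP[t _ ->] /mapP[t' _ ->] ne.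
    have [||i ik hi] := sep (val t) (val t'); first by rewrite !size_tuple.
      by move=> e; move: ne; rewrite e eqxx.
    by exists i => //; rewrite size_tuple in ik.
  rewrite size_seq_fset undup_id// size_map -cardE card_tuple card_bool.
  rewrite natrX lnXn// natrM -[ln 2 *+ k]mulr_natl; congr EFin.
  by field; rewrite !pnatr_eq0 -!lt0n m0 k0.
apply: (@lt_le_trans _ _ (ln 2 / m%:R)%:E).
  by rewrite lte_fin divr_gt0 ?ltr0n// ln_gt0// ltr1n.
apply: (@le_trans _ _ (limn_esup (sep_growth (I11 : set R^o) S eps)));
  last first.
  by apply: ereal_sup_ubound; exists eps => //=; rewrite divr_gt0// subr_gt0.
apply: limn_esup_ge => n; exists (n.+1 * m)%N; last exact: growth.
by rewrite (leq_trans (leqnSn n))// leq_pmulr.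
Qed.

Lemma Feigenbaum_no_horseshoe T : Feigenbaum T -> ~ horseshoe (T \o clamp).
Proof.
move=> [[QT cl] _] hs.
have [_ cT _] := quadratic_like_flow QT.
have /filter_ex[e [e0 he]] : \forall e \near (0 : R)^'+, 0 < e /\
    forall g, (forall y, `|g y - (T \o clamp) y| < e) -> horseshoe g.
  apply: filterI; first exact: nbhs_right_gt.
  exact: horseshoe_stable (continuous_clamp cT) hs.
have [S [QS [_ entS]] ST] := cl e e0.
have [_ cS IS] := quadratic_like_flow QS.
have : (0 < ent (I11 : set R^o) S)%E.
  apply: horseshoe_ent_gt0 => //; apply: he => y.
  by apply: (ST 0%N) => //; exact/I11E/clamp_bound.
by rewrite entS ltxx.
Qed.

End Horseshoes.

(** * Quadratic-like maps are unimodal *)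

Section Unimodal.
Context {R : realType}.
Implicit Types (T : R -> R) (x : R).

Lemma derive_I_interior T x : -1 < x < 1 -> derivable_I T x ->
  derivable T x 1 /\ T^`()%classic x = derive_I T x.
Proof.
move=> xI dT.
have sh : (h *: 1 + x) @[h --> (0 : R)^'] --> within I11 x^'.
  move=> B nB; have h : \forall y \near x, y != x -> I11 y -> B y := nB.
  have sx : (k *: 1 + x) @[k --> (0 : R)] --> x.
    rewrite -[X in _ --> X]add0r -[X in _ --> X + _](scale0r (1 : R)).
    by apply: cvgD; [apply: cvgZr_tmp; exact: cvg_id|exact: cvg_cst].
  have h' : \forall k \near (0 : R), k *: 1 + x != x -> I11 (k *: 1 + x) ->
    B (k *: 1 + x) := sx _ h.
  have hx : \forall y \near x, y \in `]-1, 1[.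
    by apply: near_in_itvoo; rewrite in_itv.
  have hI : \forall k \near (0 : R), k *: 1 + x \in `]-1, 1[ := sx _ hx.
  change (\forall k \near (0 : R), k != 0 -> B (k *: 1 + x)).
  apply: filterS2 h' hI => k hk; rewrite in_itv/= => /andP[k1 k2] k0.
  apply: hk; last by apply/I11E; rewrite !ltW.
  by rewrite -subr_eq0 addrK scaler_eq0 oner_eq0 orbF.
have dq : (h^-1 *: ((T \o shift x) (h *: 1) - T x)) @[h --> (0 : R)^']
    --> derive_I T x.
  have := cvg_comp _ _ sh dT; apply: cvg_trans.
  apply: near_eq_cvg; near=> h; rewrite /= /diff_quot addrK.
  by rewrite [_ *: 1]mulr1 mulrC.
split; first by apply/cvg_ex; exists (derive_I T x).
by rewrite derive1E; exact: cvg_lim dq.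
Unshelve. all: by end_near. Qed.

Lemma quadratic_like_level T : quadratic_like T ->
  level (T \o clamp) 0 1 (-1) 1.
Proof.
move=> QT; have [_ cT IT] := quadratic_like_flow QT.
case: QT => -[_ [dT _]] [Tm1 T1] _ [Tl Tr] _.
have dI x : -1 < x < 1 -> derivable T x 1 /\ T^`()%classic x = derive_I T x.
  by move=> hx; apply: derive_I_interior => //;
    apply: (dT 0%N) => //; apply/I11E; lra.
have incr x y : -1 <= x -> x < y -> y <= 0 -> T x < T y.
  apply: gtr0_derive1_incr => [z|z|].
  - by rewrite in_itv/= => ?; apply: (dI z _).1; lra.
  - rewrite in_itv/= => ?; rewrite (dI z _).2; last by lra.
    by apply: Tl; lra.
  - by apply: continuous_subspaceW cT => z /=;
      rewrite in_itv/= => ?; apply/I11E; lra.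
have decr x y : 0 <= x -> x < y -> y <= 1 -> T y < T x.
  apply: ltr0_derive1_decr => [z|z|].
  - by rewrite in_itv/= => ?; apply: (dI z _).1; lra.
  - rewrite in_itv/= => ?; rewrite (dI z _).2; last by lra.
    by apply: Tr; lra.
  - by apply: continuous_subspaceW cT => z /=;
      rewrite in_itv/= => ?; apply/I11E; lra.
have bd x : -1 <= (T \o clamp) x <= 1 by apply/I11E/IT/I11E/clamp_bound.
constructor => //=; rewrite ?clampK; try lra.
- move=> x hx; rewrite clampK// => Tx; have [x0|x0|//] := ltgtP x 0.
    have : T x < T 0 by apply: incr; lra.
    by rewrite Tx ltxx.
  have : T x < T 0 by apply: decr; lra.
  by rewrite Tx ltxx.
- case=> [|[|]]//= _ x y z hx hxy hyz hz; left; rewrite /= !clampK; try lra.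
  apply/andP; split.
    by move: hxy; rewrite le_eqVlt => /predU1P[->//|?]; apply/ltW/incr; lra.
  by move: hyz; rewrite le_eqVlt => /predU1P[->//|?]; apply/ltW/incr; lra.
- case=> [|[|]]//= _ x y z hx hxy hyz hz; right; rewrite /= !clampK; try lra.
  apply/andP; split.
    by move: hyz; rewrite le_eqVlt => /predU1P[->//|?]; apply/ltW/decr; lra.
  by move: hxy; rewrite le_eqVlt => /predU1P[->//|?]; apply/ltW/decr; lra.
- by move=> x _; exact: bd.
- move=> a b _ _; rewrite big_ord1 /=.
  by have := bd a; have := bd b; rewrite /= ler_norml; lra.
- by case.
Qed.

End Unimodal.

(** * Averages along two orbits *)

Section Averages.
Context {R : realType}.
Implicit Types (u : nat -> R) (C eta : R).

Lemma limn_esup_le (u : (\bar R)^nat) (l : \bar R) :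
  (\forall n \near \oo, (u n <= l)%E) -> (limn_esup u <= l)%E.
Proof.
move=> [m _ h]; rewrite limn_esup_lim; apply: lime_le.
  exact: is_cvg_esups.
exists m => // n /= mn; apply: ge_ereal_sup => _ [k /= nk <-].
by apply: h; exact: leq_trans nk.
Qed.

Lemma limn_esup_average u C eta : (forall n, u n <= C + eta * n%:R) ->
  (limn_esup (fun n => (u n / n%:R)%:E) <= eta%:E)%E.
Proof.
move=> h; apply/lee_addgt0Pr => e e0; apply: limn_esup_le.
apply: filterS2 (nbhs_infty_gt 0) (nbhs_infty_gtr (C / e)) => n n0.
rewrite ltr_pdivrMr// => Cn; rewrite -EFinD lee_fin ler_pdivrMr ?ltr0n//.
by apply: le_trans (h n) _; lra.
Qed.

Variable f : R -> R.
Local Notation dist_sum m a b :=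
  (\sum_(i < m) `|iter i.+1 f a - iter i.+1 f b|).

Lemma mean_distance_le C eta a b :
  (forall m, dist_sum m a b <= C + eta * m%:R) ->
  (@mean_distance R R^o f a b <= eta%:E)%E.
Proof.
move=> h; rewrite /mean_distance.
under eq_fun do rewrite mulrC big_add1 big_mkord.
apply: (@limn_esup_average _ C) => n; apply: le_trans (h n).
by apply: ler_sum => i _; rewrite metric_sym.
Qed.

(** Markov's inequality for the counting averages. *)
Lemma upper_density_le C eta (eps : R) a b : 0 < eps ->
  (forall m, dist_sum m a b <= C + eta * m%:R) ->
  (upper_density [set n | (eps <= `|iter n f a - iter n f b|)%R]
    <= (eta / eps)%:E :> \bar R)%E.
Proof.
move=> eps0 h; rewrite /upper_density.
apply: (@limn_esup_average _ (C / eps)) => n.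
have -> : C / eps + eta / eps * n%:R = (C + eta * n%:R) / eps.
  by field; rewrite gt_eqF.
rewrite ler_pdivlMr//; apply: le_trans (h n).
rewrite big_add1 big_mkord natr_sum mulr_suml; apply: ler_sum => i _.
case: (boolP (_ \in _)) => [|_]; last by rewrite mul0r.
by rewrite inE/= mul1r.
Qed.

End Averages.

(** * Minimal subsets *)

Section Subflows.
Context {R : realType}.
Variables (f : R -> R) (X : set R).
Hypotheses (cf : continuous f) (cX : compact X) (fX : forall x, X x -> X (f x)).
Implicit Types (K : set R) (x y z : R).

Definition orbit x := [set iter n f x | n in [set: nat]].

Local Notation minimal K := (minimal_subset (X : set R^o) f K).

Let X_closed : closed X. Proof. exact: compact_closed (@Rhausdorff R) cX. Qed.

Lemma closure_orbit_iter x y k :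
  closure (orbit x) y -> closure (orbit (iter k f x)) (iter k f y).
Proof.
move=> xy B nB.
have /xy[_ [[n _ <-] Bn]] : nbhs y (iter k f @^-1` B).
  exact: (@continuous_iter _ _ k cf).
exists (iter k f (iter n f x)); split=> //.
by exists n => //; rewrite -!iterD addnC.
Qed.

Lemma orbit_iter_sub x k : orbit (iter k f x) `<=` orbit x.
Proof. by move=> _ [n _ <-]; exists (n + k)%N; rewrite // iterD. Qed.

Lemma closure_orbit_stable x y :
  closure (orbit x) y -> closure (orbit x) (f y).
Proof.
by move=> /(@closure_orbit_iter _ _ 1); apply/closureS/(@orbit_iter_sub _ 1).
Qed.

Lemma orbit_iter_in K x k : (forall y, K y -> K (f y)) -> K x ->
  K (iter k f x).
Proof. by move=> fK Kx; elim: k => //= k; exact: fK. Qed.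

(** The delay (N - 1) k completes the delay k to a multiple of N. *)
Lemma iter_complement N k w : (0 < N)%N ->
  iter k f (iter (N.-1 * k) f w) = iter (k * N) f w.
Proof. by case: N => // N _; rewrite -iterD -mulSn mulnC. Qed.

(** Zorn's lemma is applied to the complements U of closed invariant subsets of
    Y.  The union of a chain of such U does not cover Y, by compactness. *)
Lemma minimal_subset_exists (Y : set R) : Y `<=` X -> Y !=set0 -> closed Y ->
  (forall y, Y y -> Y (f y)) -> exists2 K, minimal K & K `<=` Y.
Proof.
move=> YX Y0 Ycl fY.
have Yc : compact Y by exact: subclosed_compact Ycl cX YX.
pose P (U : set R) := [/\ open U, Y `\` U !=set0 &
  forall y, Y y -> ~ U y -> ~ U (f y)].
have [|A [[oA A0 fA] maxA]] := @Zorn_bigcup _ P.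
  move=> F FP Ft; split.
  - by apply: bigcup_open => U /FP[].
  - have [[U0 FU0]|/forallNP F0] := pselect (exists U, F U); last first.
      have [y Yy] := Y0; exists y; split=> // -[U /F0].
      by [].
    have FF : ProperFilter (filter_from F (fun U => Y `\` U)).
      apply: filter_from_proper; last by move=> U /FP[].
      apply: filter_from_filter; first by exists U0.
      move=> U V FU FV; have [UV|VU] := Ft _ _ FU FV.
        by exists V => // y [Yy Vy]; split; split=> // /UV.
      by exists U => // y [Yy Uy]; split; split=> // /VU.
    have [y [Yy cy]] : Y `&` cluster (filter_from F (fun U => Y `\` U)) !=set0.
      by apply: Yc; exists U0 => // y [].
    exists y; split=> // -[U FU Uy].
    have [oU _ _] := FP _ FU.
    have [||z [[_ nUz] Uz]] := cy (Y `\` U) U; last exact: nUz.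
      by exists U.
    exact: open_nbhs_nbhs.
  - move=> y Yy nUy [U FU Ufy]; have [_ _ fU] := FP _ FU.
    by apply: (fU y Yy _ Ufy) => Uy; apply: nUy; exists U.
exists (Y `\` A); last by move=> y [].
split=> //.
- by move=> y [/YX].
- by apply: closedI => //; exact: open_closedC.
- by move=> y [Yy Ay]; split; [exact: fY|exact: fA].
move=> x [Yx Ax] w [Yw Aw]; apply: contrapT => xw.
apply: (maxA (A `|` ~` closure (orbit x))).
  by split=> [y|h]; [left|apply: Aw; apply: h; right].
split.
- by apply: openU => //; exact/closed_openC/closed_closure.
- exists x; split=> // -[//|]; apply; apply: subset_closure; by exists 0%N.
- move=> y Yy /not_orP[nAy /contrapT xy] [|]; first exact: fA.
  by apply; exact: closure_orbit_stable.
Qed.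

Section PeriodicOrbit.
Variables (N : nat) (z : R).
Hypotheses (N0 : (0 < N)%N) (Nz : iter N f z = z).

Lemma iter_period i n : iter (i + n * N) f z = iter i f z.
Proof. by rewrite iterD iterM (iter_fix n Nz). Qed.

Lemma orbit_period i : exists2 j, (j < N)%N & iter i f z = iter j f z.
Proof.
exists (i %% N)%N; first by rewrite ltn_mod.
by rewrite {1}(divn_eq i N) addnC iter_period.
Qed.

Lemma finite_orbit : finite_set (orbit z).
Proof.
apply: (@sub_finite_set _ _ ((fun i => iter i f z) @` `I_N)).
  by move=> _ [i _ <-]; have [j jN ->] := orbit_period i; exists j.
exact/finite_image/finite_II.
Qed.

Lemma closed_finite K : finite_set K -> closed K.
Proof.
exact: (accessible_finite_set_closed.1 (hausdorff_accessible (@Rhausdorff R))).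
Qed.

Lemma orbit_minimal : X z -> minimal (orbit z).
Proof.
move=> Xz; split.
- by move=> _ [i _ <-]; exact: orbit_iter_in.
- by exists z; exists 0%N.
- exact: (closed_finite finite_orbit).
- by move=> _ [i _ <-]; exists i.+1.
move=> _ [i _ <-] _ [j _ <-]; apply: subset_closure.
exists (j + i * N.-1)%N => //; rewrite -iterD.
by rewrite -addnA -{2}(muln1 i) -mulnDr addn1 prednK// iter_period.
Qed.

End PeriodicOrbit.

(** A form of the Lebesgue number lemma: S w is a neighbourhood in K of each
    point w, and points at distance less than delta share such a
    neighbourhood. *)
Lemma lebesgue_number K (S : R -> R -> Prop) : compact K ->
  (forall w, K w -> \forall y \near w, K y -> S w y) ->
  exists2 delta : R, 0 < delta & forall x y, K x -> K y ->
    `|x - y| < delta -> exists w, [/\ K w, S w x & S w y].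
Proof.
move=> cK h.
pose P (d : R) x := K x -> forall y, K y -> `|x - y| < d ->
  exists w, [/\ K w, S w x & S w y].
have : \forall d \near (0 : R)^'+, K `<=` P d.
  move/compact_near_coveringP: cK; apply => w Kw.
  have /nbhs_ballP[e /= e0 he] := h w Kw.
  have e2 : 0 < e / 2 by rewrite divr_gt0.
  exists (ball w (e / 2), [set d | d < e / 2]).
    by split=> /=; [exact: nbhsx_ballx|exact: nbhs_right_lt].
  move=> [x d] [/= wx de] Kx y Ky xy; exists w; split=> //.
    by apply: he => //; apply: le_ball wx; lra.
  apply: he => //; move: wx; rewrite /ball/= => wx.
  rewrite -(subrKA x) (le_lt_trans (ler_normD _ _))//.
  by have := lt_trans xy de; lra.
move=> hK; have /filter_ex[d [d0 hd]] :
    \forall d \near (0 : R)^'+, 0 < d /\ K `<=` P d.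
  by apply: filterI => //; exact: nbhs_right_gt.
by exists d => // x y Kx; exact: hd.
Qed.

Lemma finite_MLS K : compact K -> finite_set K -> MLS (K : set R^o) f.
Proof.
move=> cK fK eps eps0.
have [w Kw|d d0 hd] := @lebesgue_number K (fun w y => y = w) cK.
  have : nbhs w (~` (K `\ w)).
    apply: open_nbhs_nbhs; split; last by move=> [_]; exact.
    by apply: closed_openC; apply: closed_finite; exact: finite_setD.
  by apply: filterS => y nKy Ky; apply: contrapT => yw; apply: nKy.
exists d => // x y Kx Ky; rewrite metric_sym => xy.
have [w [_ -> ->]] := hd _ _ Kx Ky xy.
exists set0 => [|n _]; last by rewrite mdistxx.
rewrite (@le_lt_trans _ _ 0%E)//.
apply: limn_esup_le; apply: nearW => n.
by rewrite big1 ?mul0r// => i _; rewrite in_set0.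
Qed.

(** * From the dichotomy of orbits to MMA and MMLS *)

Section CriticalPoint.
Variable c : R.

Definition enters_deep_levels x := forall n, exists N u v k,
  [/\ level f c N u v, (n <= N)%N & u <= iter k f x <= v].

Hypothesis dichotomy : forall x, X x ->
  tends_to_cycle f x \/ enters_deep_levels x.

(** An orbit that starts in [u, v] is back there at all multiples of N.  So it
    is in the union D of the inverse images of [u, v] under f, ..., f^N, and D
    is closed. *)
Lemma level_cover N u v x y : level f c N u v -> u <= x <= v ->
  closure (orbit x) y -> exists2 j, (j < N)%N & u <= iter j.+1 f y <= v.
Proof.
move=> L xJ xy; have N0 := level_gt0 L.
pose D := \bigcup_(j in `I_N) (iter j.+1 f @^-1` `[u, v]%classic).
have cD : closed D.
  apply: closed_bigcup => [|j _]; first exact: finite_II.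
  apply: preimage_closed; last exact: interval_closed.
  by move=> ? _; exact: (@continuous_iter _ _ j.+1 cf).
have xD : orbit x `<=` D.
  move=> _ [n _ <-]; exists (N.-1 - n %% N)%N; first by rewrite /=; lia.
  rewrite /preimage /mkset in_itv -iterD.
  have -> : ((N.-1 - n %% N).+1 + n = (n %/ N).+1 * N)%N.
    have := divn_eq n N; have := ltn_pmod n N0; rewrite mulSn; lia.
  exact: (level_stable_mul _ L xJ).
have [j jN] : D y by move: xy; rewrite closureE; apply; split.
by rewrite /= in_itv; exists j.
Qed.

(** The point f^((N - 1) k) z of the cycle is at z at time k, as x is in the
    limit. *)
Lemma cycle_limit_dist k N x z : (0 < N)%N -> iter N f z = z ->
  (fun n => iter (k + N * n) f x) @ \oo --> z ->
  forall eta : R, 0 < eta -> exists M, forall m, (M <= m)%N ->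
    `|iter m f x - iter m f (iter (N.-1 * k) f z)| <= eta.
Proof.
move=> N0 Nz xz eta eta0.
have : \forall n \near \oo, forall i : 'I_N,
    `|iter i f z - iter i f (iter (k + N * n) f x)| < eta.
  apply: filter_forall => i.
  have /cvgrPdist_lt : iter i f (iter (k + N * n) f x) @[n --> \oo]
      --> iter i f z.
    exact: cvg_comp xz (@continuous_iter _ _ i cf z).
  exact.
move=> [n0 _ hn]; exists (k + N * n0)%N => m hm.
have kz : iter k f (iter (N.-1 * k) f z) = z.
  by rewrite iter_complement// iterM iter_fix.
set r := (m - k)%N.
have mE : m = (r + k)%N by rewrite /r subnK// (leq_trans _ hm)// leq_addr.
have hr : (n0 <= r %/ N)%N by rewrite leq_divRL// /r; lia.
have -> : iter m f (iter (N.-1 * k) f z) = iter (r %% N) f z.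
  by rewrite mE iterD kz {1}(divn_eq r N) addnC (iter_period Nz).
have -> : iter m f x = iter (r %% N) f (iter (k + N * (r %/ N)) f x).
  rewrite -iterD; congr (iter _ f x).
  by rewrite mE {1}(divn_eq r N); lia.
rewrite distrC; apply: ltW.
have rN : (r %% N < N)%N by rewrite ltn_mod.
exact: (hn _ hr (Ordinal rN)).
Qed.

Lemma cycle_limit_sub K k N x z : closed K -> (forall y, K y -> K (f y)) ->
  K x -> (fun n => iter (k + N * n) f x) @ \oo --> z -> K z.
Proof.
move=> Kcl fK Kx; apply: (closed_cvg _ Kcl).
by apply: nearW => n; exact: orbit_iter_in.
Qed.

(** When x enters deep intervals, K is any minimal subset of its orbit closure.
    It meets [u, v] by [level_cover]; moving such a point by (N - 1) k steps
    gives a point of K that is in [u, v] at time k, like x. *)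
Lemma MMA_of_dichotomy : MMA (X : set R^o) f.
Proof.
apply/seteqP; split=> [x Xx|x [K _ []]//].
have [[k [N [z [N0 Nz xz]]]]|deep] := dichotomy Xx.
  have Xz : X z := cycle_limit_sub X_closed fX Xx xz.
  exists (orbit z); first exact: orbit_minimal N0 Nz Xz.
  split=> // eps eps0; exists (iter (N.-1 * k) f z).
    by exists (N.-1 * k)%N.
  have e2 : 0 < eps / 2 by rewrite divr_gt0.
  have [M hM] := cycle_limit_dist N0 Nz xz e2.
  set z' := iter _ f z in hM *.
  apply: (@le_lt_trans _ _ (eps / 2)%:E); last by rewrite lte_fin; lra.
  apply: (@mean_distance_le _ _
    (\sum_(i < M) `|iter i.+1 f x - iter i.+1 f z'|)) => m.
  apply: (@le_trans _ _
    (\sum_(i < M + m) `|iter i.+1 f x - iter i.+1 f z'|)).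
    by rewrite addnC big_split_ord/= lerDl; exact: sumr_ge0.
  rewrite big_split_ord/= lerD2l.
  rewrite (@le_trans _ _ (\sum_(i < m) eps / 2))//.
    apply: ler_sum => i _; rewrite -!iterS; apply: hM;
    by rewrite leqW// leq_addr.
  by rewrite sumr_const card_ord mulr_natr.
have [||||K Kmin Kx] := @minimal_subset_exists (closure (orbit x)).
- move=> y; rewrite closureE; apply; split=> //.
  by move=> _ [n _ <-]; exact: orbit_iter_in.
- by exists x; apply: subset_closure; exists 0%N.
- exact: closed_closure.
- by move=> y; exact: closure_orbit_stable.
have [_ [y Ky] _ fK _] := Kmin.
exists K => //; split=> // eps eps0.
have [N [u [v [k [L nN hk]]]]] := deep (Num.bound (2 / eps)).+1.
have N0 := level_gt0 L.
have Ne : 2 / N%:R < eps.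
  have : 2 / eps < N%:R.
    apply: lt_le_trans (_ : (Num.bound (2 / eps))%:R <= _);
      last by rewrite ler_nat ltnW.
    by rewrite archi_boundP// divr_ge0// ltW.
  by rewrite !ltr_pdivrMr ?ltr0n// mulrC.
have [j _ hj] := level_cover L hk (@closure_orbit_iter _ _ k (Kx _ Ky)).
exists (iter (N.-1 * k) f (iter (j.+1 + k) f y)).
  by apply: orbit_iter_in => //; exact: orbit_iter_in.
apply: le_lt_trans (_ : (2 / N%:R)%:E < _)%E; last by rewrite lte_fin.
have hz : u <= iter k f (iter (N.-1 * k) f (iter (j.+1 + k) f y)) <= v.
  by rewrite iter_complement//; apply: (level_stable_mul _ L); rewrite iterD.
set z := iter (N.-1 * k) f _ in hz *.
apply: (@mean_distance_le _ _
  (\sum_(i < k) `|iter i.+1 f x - iter i.+1 f z| + 2)) => m.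
exact: (synchronized_dist_sum m L hk hz).
Qed.

Lemma periodic_minimal_finite K z : minimal K -> K z -> periodic f z ->
  finite_set K.
Proof.
move=> [_ _ _ _ Kdense] Kz [N N0 Nz].
apply: sub_finite_set (finite_orbit N0 Nz) => y /(Kdense z Kz).
by rewrite closureE; apply; split=> //;
  exact: (closed_finite (finite_orbit N0 Nz)).
Qed.

(** A minimal set with a periodic point is finite.  Otherwise each point of K is
    in [u, v] at exactly one of the times 1, ..., N, since a point that is there
    twice would be periodic.  This time is locally constant on the compact set
    K, and points with the same time are synchronized. *)
Lemma MMLS_of_dichotomy : MMLS (X : set R^o) f.
Proof.
move=> K Kmin; have [KX [x Kx] Kcl fK Kdense] := Kmin.
have cK : compact K by exact: subclosed_compact Kcl cX KX.
have [[z Kz zper]|/forall2NP noper] := pselect (exists2 z, K z & periodic f z).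
  exact: finite_MLS cK (periodic_minimal_finite Kmin Kz zper).
have {}noper z : K z -> ~ periodic f z by move=> Kz; case: (noper z).
have [[k [N [z [N0 Nz xz]]]]|deep] := dichotomy (KX _ Kx).
  by case: (noper z (cycle_limit_sub Kcl fK Kx xz)); exists N.
move=> eps eps0.
have [N [u [v [k [L nN hk]]]]] := deep (Num.bound (2 / eps / eps)).+1.
have N0 := level_gt0 L.
have Ne : 2 / N%:R / eps < eps.
  have : 2 / eps / eps < N%:R.
    apply: lt_le_trans (_ : (Num.bound (2 / eps / eps))%:R <= _);
      last by rewrite ler_nat ltnW.
    by rewrite archi_boundP// !divr_ge0// ltW.
  rewrite !ltr_pdivrMr ?ltr0n// => h; by rewrite mulrC mulrA.
have cover y : K y -> exists2 j, (j < N)%N & u <= iter j.+1 f y <= v.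
  by move=> /(Kdense _ (orbit_iter_in k fK Kx)); exact: level_cover.
have uniq_idx_lt y i j : K y -> (i < j < N)%N -> u <= iter i.+1 f y <= v ->
    ~ u <= iter j.+1 f y <= v.
  move=> Ky /andP[ij jN] hi hj; apply: (noper (iter j.+1 f y)).
    exact: orbit_iter_in.
  have e : iter j.+1 f y = iter (j - i) f (iter i.+1 f y).
    by rewrite -iterD addnS subnK// ltnW.
  by rewrite e; apply: (level_return L) => //; [lia|rewrite -e].
have uniq_idx y i j : K y -> (i < N)%N -> (j < N)%N ->
    u <= iter i.+1 f y <= v -> u <= iter j.+1 f y <= v -> i = j.
  move=> Ky iN jN hi hj; have [ij|ji|//] := ltngtP i j.
    by case: (@uniq_idx_lt y i j Ky _ hi hj); rewrite ij.
  by case: (@uniq_idx_lt y j i Ky _ hj hi); rewrite ji.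
pose S w y := forall j, (j < N)%N -> u <= iter j.+1 f w <= v ->
  u <= iter j.+1 f y <= v.
have [w Kw|d d0 hd] := @lebesgue_number K S cK.
  have : \forall y \near w, forall i : 'I_N,
      ~ (u <= iter i.+1 f w <= v) -> ~ (u <= iter i.+1 f y <= v).
    have near_all := @filter_forall R 'I_N (fun (i : 'I_N) (y : R) =>
      ~ (u <= iter i.+1 f w <= v) -> ~ (u <= iter i.+1 f y <= v)) (nbhs w)
      (nbhs_filter w).
    apply: near_all => i.
    have [hi|hi] := pselect (u <= iter i.+1 f w <= v).
      by apply: nearW => y h _; apply: h.
    have : nbhs w (~` (iter i.+1 f @^-1` `[u, v]%classic)).
      apply: open_nbhs_nbhs; split; last by rewrite /= in_itv.
      apply: closed_openC; apply: preimage_closed; last exact: interval_closed.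
      by move=> ? _; exact: (@continuous_iter _ _ i.+1 cf).
    by move=> hw; apply: (filterS _ hw) => y; rewrite /= in_itv => h _.
  move=> hw; apply: (filterS _ hw) => y hy Ky j jN hj.
  have [i iN hi] := cover _ Ky.
  have hwi : u <= iter i.+1 f w <= v.
    by apply: contrapT => /(hy (Ordinal iN)); apply.
  by rewrite (uniq_idx w j i).
exists d => // a b Ka Kb; rewrite metric_sym => ab.
have [w [Kw wa wb]] := hd _ _ Ka Kb ab.
have [j jN hj] := cover _ Kw.
exists [set n | eps <= `|iter n f a - iter n f b|] => [|n /= /negP].
  apply: (@le_lt_trans _ _ (2 / N%:R / eps)%:E); last by rewrite lte_fin.
  apply: (@upper_density_le _ _
    (\sum_(i < j.+1) `|iter i.+1 f a - iter i.+1 f b| + 2)) => // m.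
  exact: (synchronized_dist_sum m L (wa j jN hj) (wb j jN hj)).
by rewrite -ltNge distrC.
Qed.

End CriticalPoint.
End Subflows.

(** * Changing the map outside the flow *)

Section Transfer.
Context {R : realType}.
Variables (X : set R) (f T : R -> R).
Hypotheses (TX : forall x, X x -> X (T x)) (fT : forall x, X x -> f x = T x).

Let iterE n x : X x -> X (iter n T x) /\ iter n f x = iter n T x.
Proof.
move=> Xx; elim: n => [|n [Xn IHn]] //=.
by split; [exact: TX|rewrite IHn fT].
Qed.

Lemma minimal_subset_eq K : minimal_subset (X : set R^o) f K <->
  minimal_subset (X : set R^o) T K.
Proof.
have oE x : X x -> [set iter n f x | n in [set: nat]] =
    [set iter n T x | n in [set: nat]].
  by move=> Xx; apply: eq_imagel => n _; have [] := iterE n Xx.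
split=> -[KX K0 Kcl fK Kd]; split=> // x Kx.
- by rewrite -fT; [exact: fK|exact: KX].
- by rewrite -oE; [exact: Kd|exact: KX].
- by rewrite fT; [exact: fK|exact: KX].
- by rewrite oE; [exact: Kd|exact: KX].
Qed.

Lemma MMA_eq : MMA (X : set R^o) f -> MMA (X : set R^o) T.
Proof.
move=> h; apply/seteqP; split=> [x|x [K _ []]//]; rewrite {1}h.
move=> [K /minimal_subset_eq Kmin [Xx Kx]].
exists K; first exact: Kmin.
split; first exact: Xx.
move=> eps eps0; have [z Kz hz] := Kx eps eps0; exists z; first exact: Kz.
have [KX _ _ _ _] := Kmin; apply: le_lt_trans hz.
rewrite le_eqVlt; apply/orP; left; apply/eqP.
congr limn_esup; apply/funext => n; congr (_ * _)%:E.
apply: eq_bigr => i _; have [_ ->] := iterE i Xx.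
by have [_ ->] := iterE i (KX _ Kz).
Qed.

Lemma MMLS_eq : MMLS (X : set R^o) f -> MMLS (X : set R^o) T.
Proof.
move=> h K Kmin eps eps0; have [KX _ _ _ _] := Kmin.
have [d d0 hd] := h K ((minimal_subset_eq K).2 Kmin) eps eps0.
exists d => // x y Kx Ky xy; have [E dE hE] := hd x y Kx Ky xy.
exists E => // n /hE; have [_ ->] := iterE n (KX _ Kx).
by have [_ ->] := iterE n (KX _ Ky).
Qed.

End Transfer.

Theorem theorem6 (R : realType) (T : R -> R) (hT : Feigenbaum T) :
  MMA I11 T /\ MMLS I11 T.
Proof.
have nhs := Feigenbaum_no_horseshoe hT.
have [[QT _] _] := hT.
have [cI cT IT] := quadratic_like_flow QT.
have cf := continuous_clamp cT.
have fI x : I11 x -> I11 ((T \o clamp) x).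
  by move=> _; apply/IT/I11E/clamp_bound.
have fT (x : R) : I11 x -> (T \o clamp) x = T x.
  by move=> /I11E xI; rewrite /= clampK.
have dich x : I11 x ->
    tends_to_cycle (T \o clamp) x \/ enters_deep_levels (T \o clamp) 0 x.
  move=> /I11E xI; have [|ntc] := pselect (tends_to_cycle (T \o clamp) x).
    by left.
  right=> n.
  by have [|] := deep_level n cf nhs (quadratic_like_level QT) xI.
split.
  by apply: (MMA_eq IT fT); exact: MMA_of_dichotomy dich.
by apply: (MMLS_eq IT fT); exact: MMLS_of_dichotomy dich.
Qed.
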